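(* Let $G$ be a group and let $c\colon \mathscr G\to G$ be a $G$-graded Hausdorff ample groupoid. Then $\mathscr G\cong \Gamma_c^h(\mathscr G)\ltimes \widehat{E(\Gamma_c^h(\mathscr G))}$ as $G$-graded groupoids (i.e., there is an isomorphism of topological groupoids commuting with the cocycles to $G$).
   Context: Groupoids. A groupoid $\mathscr G$ is a small category with all arrows invertible; $\mathscr G^{(0)}$ is the set of objects (identified with the identity arrows), $\mathscr G^{(1)}$ the set of arrows, $\boldsymbol d,\boldsymbol r$ the domain and range maps; $\alpha\beta$ is defined when $\boldsymbol d(\alpha)=\boldsymbol r(\beta)$. A topological groupoid has topologies making all structure maps continuous; it is étale if $\boldsymbol d$ is a local homeomorphism. A Boolean space is a Hausdorff space with a basis of compact open sets. An ample groupoid is an étale groupoid with $\mathscr G^{(0)}$ a Boolean space; it is Hausdorff if $\mathscr G^{(1)}$ is Hausdorff. A $G$-graded groupoid is a topological groupoid with a continuous functor (cocycle) $c\colon\mathscr G\to G$, $G$ being a discrete one-object groupoid. An isomorphism of topological groupoids is a continuous functor with a continuous inverse. Local bisections. A local bisection is an open subset $U\subseteq\mathscr G^{(1)}$ on which $\boldsymbol d$ and $\boldsymbol r$ are injective; it is homogeneous if $U\subseteq c^{-1}(g)$ for some $g\in G$. $\Gamma_c^h(\mathscr G)$ is the inverse semigroup of homogeneous compact local bisections under $UV=\{\alpha\beta\mid\alpha\in U,\beta\in V,\ \boldsymbol d(\alpha)=\boldsymbol r(\beta)\}$ (inverse $U^{-1}=\{\gamma^{-1}\mid\gamma\in U\}$,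 zero $\emptyset$). It is $G$-graded by $\theta(U)=g$ for $\emptyset\ne U\subseteq c^{-1}(g)$. Its idempotent semilattice is the generalized Boolean algebra of compact open subsets of $\mathscr G^{(0)}$. Inverse semigroups and germs. In an inverse semigroup $S$ ($s^*$ denotes the inverse of $s$), $E(S)$ is the commutative semilattice of idempotents, and $s\le t$ means $s=te$ for some $e\in E(S)$. For a meet semilattice $E$ with zero, a character is a non-zero, zero-preserving semilattice homomorphism $\tau\colon E\to\{0,1\}$; $\widehat E$ is the set of characters maximal for the pointwise order, with the topology of pointwise convergence. If $E(S)$ is a generalized Boolean algebra, then $\widehat{E(S)}$ is a Boolean space and $S$ acts on it: $s\in S$ acts as a partial homeomorphism with domain $\{\tau\mid\tau(s^*s)=1\}$ and range $\{\tau\mid\tau(ss^* )=1\}$ by $(s\tau)(e)=\tau(s^*es)$. For an action of $S$ on a Boolean space $X$ by partial homeomorphisms with compact open domains, with $X_e$ the domain of $e\in E(S)$, the groupoid of germs $S\ltimes X$ has object space $X$ and arrows the classes $[s,x]$ of pairs $(s,x)$ with $x\in X_{s^*s}$, where $(s,x)\sim(t,y)$ iff $x=y$ and there is $u\le s,t$ with $x\in X_{u^*u}$. The sets $(s,U)=\{[s,x]\mid x\in U\}$, $U\subseteq X_{s^*s}$ open, form a basis of the topology; $\boldsymbol d([s,x])=x$, $\boldsymbol r([s,x])=sx$, $[s,tx][t,x]=[st,x]$, $[s,x]^{-1}=[s^*,sx]$. If $S$ is $G$-graded by $\theta\colon S\setminus\{0\}\to G$ (with $\theta(st)=\theta(s)\theta(t)$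 when $st\ne0$) and $0$ acts as the empty map, then $S\ltimes X$ is $G$-graded by $[s,x]\mapsto\theta(s)$. *)

(* Defs.v *)
From HB Require Import structures.
From mathcomp Require Import all_boot all_order generic_quotient.
From mathcomp Require Import all_classical topology.

Set Implicit Arguments.
Unset Strict Implicit.
Unset Printing Implicit Defensive.

Local Open Scope classical_set_scope.
Local Open Scope group_scope.
Local Open Scope quotient_scope.

HB.mixin Record Semigroup_isInverse0 S of Semigroup S := {
  star : S -> S;
  zero : S;
  mul_starK : forall s : S, s * star s * s = s;
  star_mulK : forall s : S, star s * s * star s = star s;
  star_unique : forall s t : S, s * t * s = s -> t * s * t = t -> t = star s;
  mul0s : forall s : S, zero * s = zero;
  muls0 : forall s : S, s * zero = zero
}.

#[short(type="invSemigroup0Type")]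
HB.structure Definition InvSemigroup0 :=
  {S of Semigroup_isInverse0 S & Semigroup S}.

Arguments zero {s}.

Notation "s ^*" := (star s) : group_scope.

Section InvSemigroupTheory.
Variable S : invSemigroup0Type.
Implicit Types s t u v e f : S.

Lemma starK s : s^* ^* = s.
Proof. by rewrite -(@star_unique S _ _ (star_mulK s) (mul_starK s)). Qed.

Lemma star_idem e : e * e = e -> e^* = e.
Proof. by move=> ee; rewrite -(@star_unique S e e) ?ee. Qed.

Lemma star_mulP s : (s^* * s) * (s^* * s) = s^* * s.
Proof. by rewrite mulgA star_mulK. Qed.

Lemma mul_starP s : (s * s^*) * (s * s^*) = s * s^*.
Proof. by rewrite mulgA mul_starK. Qed.

Lemma idem_mul_idem e f : e * e = e -> f * f = f -> (e * f) * (e * f) = e * f.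
Proof.
move=> ee ff; pose x := (e * f)^*.
have H1 : e * f * x * (e * f) = e * f by exact: mul_starK.
have H2 : x * (e * f) * x = x by exact: star_mulK.
have xE : f * x * e = x.
  apply: (@star_unique S (e * f) (f * x * e)).
    by rewrite -[RHS]H1 !mulgA -(mulgA e f f) ff -(mulgA _ e e) ee.
  transitivity (f * (x * (e * f) * x) * e); last by rewrite H2.
  by rewrite !mulgA -(mulgA _ e e) ee -(mulgA _ f f) ff.
have xx : x * x = x.
  transitivity (f * x * e * (f * x * e)); first by rewrite xE.
  transitivity (f * (x * (e * f) * x) * e); last by rewrite H2.
  by rewrite !mulgA.
have -> : e * f = x^* by rewrite starK.
by rewrite star_idem.
Qed.

Lemma idem_comm e f : e * e = e -> f * f = f -> e * f = f * e.
Proof.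
move=> ee ff; have ef := idem_mul_idem ee ff; have fe := idem_mul_idem ff ee.
suff -> : f * e = (e * f)^* by rewrite star_idem.
apply: star_unique.
  by rewrite -[RHS]ef !mulgA -(mulgA e f f) ff -(mulgA _ e e) ee.
by rewrite -[RHS]fe !mulgA -(mulgA f e e) ee -(mulgA _ f f) ff.
Qed.

Lemma star_mul s t : (s * t)^* = t^* * s^*.
Proof.
symmetry; have C := idem_comm (mul_starP t) (star_mulP s).
apply: star_unique.
  transitivity (s * ((t * t^* ) * (s^* * s)) * t); first by rewrite !mulgA.
  rewrite C; transitivity ((s * s^* * s) * (t * t^* * t)).
    by rewrite !mulgA.
  by rewrite !mul_starK.
transitivity (t^* * ((s^* * s) * (t * t^* )) * s^* ); first by rewrite !mulgA.
rewrite -C; transitivity ((t^* * t * t^* ) * (s^* * s * s^* )).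
  by rewrite !mulgA.
by rewrite !star_mulK.
Qed.

Lemma conj_idem s e : e * e = e -> (s^* * e * s) * (s^* * e * s) = s^* * e * s.
Proof.
move=> ee; rewrite !mulgA -(mulgA _ s s^*) -(mulgA (s^*) e).
rewrite (idem_comm ee (mul_starP s)) !mulgA star_mulK.
by rewrite -(mulgA _ e e) ee.
Qed.

Lemma idem_pass s e : e * e = e -> e * s = s * (s^* * e * s).
Proof.
move=> ee; rewrite !mulgA -(idem_comm ee (mul_starP s)) -!mulgA.
by rewrite (mulgA s) mul_starK.
Qed.

Definition ile s t := exists2 e, e * e = e & s = t * e.

Lemma ile_refl s : ile s s.
Proof. by exists (s^* * s); [exact: star_mulP | rewrite mulgA mul_starK]. Qed.

Lemma ile_mulr s e : e * e = e -> ile (s * e) s.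
Proof. by exists e. Qed.

Lemma ile_mull s e : e * e = e -> ile (e * s) s.
Proof. by move=> ee; exists (s^* * e * s); [exact: conj_idem|exact: idem_pass]. Qed.

Lemma ile_trans s t u : ile s t -> ile t u -> ile s u.
Proof.
move=> [e ee ->] [f ff ->]; exists (f * e); last by rewrite mulgA.
exact: idem_mul_idem.
Qed.

Lemma ile_mul s t u v : ile u s -> ile v t -> ile (u * v) (s * t).
Proof.
move=> [e ee ->] [f ff ->]; apply: (@ile_trans _ (s * (e * t))).
  by exists f => //; rewrite !mulgA.
rewrite (idem_pass t ee) mulgA; exists (t^* * e * t) => //.
exact: conj_idem.
Qed.

Lemma ile_star s t : ile s t -> ile s^* t^*.
Proof. by move=> [e ee ->]; rewrite star_mul (star_idem ee); apply: ile_mull. Qed.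

End InvSemigroupTheory.

Record idempotents (S : invSemigroup0Type) := Idempotent {
  idem_val :> S;
  idem_valP : idem_val * idem_val == idem_val
}.

HB.instance Definition _ (S : invSemigroup0Type) :=
  [isSub for @idem_val S].
HB.instance Definition _ (S : invSemigroup0Type) :=
  [Choice of idempotents S by <:].

Fact idem_display : Order.disp_t. Proof. exact: Order.Disp tt tt. Qed.

Section IdempotentSemilattice.
Variable S : invSemigroup0Type.
Implicit Types e f g : idempotents S.

Lemma idemE e : idem_val e * idem_val e = idem_val e.
Proof. exact/eqP/idem_valP. Qed.

Lemma idem_meetP e f : (val e * val f) * (val e * val f) == val e * val f.
Proof. by apply/eqP/idem_mul_idem; exact: idemE. Qed.

Lemma idem_zeroP : zero * zero == zero :> S.
Proof. by rewrite mul0s. Qed.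

Definition idem_meet e f := Idempotent (idem_meetP e f).
Definition idem_zero : idempotents S := Idempotent idem_zeroP.
Definition idem_le e f := idem_meet e f == e.
Definition idem_lt e f := (f != e) && idem_le e f.

Lemma idem_meetC : commutative idem_meet.
Proof. by move=> e f; apply: val_inj; apply: idem_comm; exact: idemE. Qed.
Lemma idem_meetA : associative idem_meet.
Proof. by move=> e f g; apply: val_inj; exact: mulgA. Qed.
Lemma idem_meetxx e : idem_meet e e = e.
Proof. by apply: val_inj; exact: idemE. Qed.

Fact idem_le_refl : reflexive idem_le.
Proof. by move=> e; rewrite /idem_le idem_meetxx. Qed.
Fact idem_le_anti : antisymmetric idem_le.
Proof. by move=> e f /andP[/eqP ef /eqP fe]; rewrite -ef idem_meetC. Qed.
Fact idem_le_trans : transitive idem_le.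
Proof.
by move=> f e g /eqP ef /eqP fg; apply/eqP; rewrite -{1}ef -idem_meetA fg.
Qed.

HB.instance Definition _ := @Order.isPOrder.Build idem_display (idempotents S)
  idem_le idem_lt (fun _ _ => erefl) idem_le_refl idem_le_anti idem_le_trans.
HB.instance Definition _ := @Order.POrder_Meet_isSemilattice.Build idem_display
  (idempotents S) idem_meet idem_meetC idem_meetA (fun _ _ => erefl).

Fact idem_le0 e : (idem_zero <= e)%O.
Proof. by apply/eqP; apply: val_inj; exact: mul0s. Qed.

HB.instance Definition _ := @Order.hasBottom.Build idem_display (idempotents S)
  idem_zero idem_le0.

End IdempotentSemilattice.

Section Spectrum.
Context {disp : Order.disp_t}.
Variable E : bMeetSemilatticeType disp.
Implicit Types tau sigma : E -> bool.

Definition is_character tau :=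
  [/\ exists e, tau e,
      tau \bot%O = false &
      {morph tau : e f / (e `&` f)%O >-> e && f}].

Definition char_le tau sigma := forall e, tau e -> sigma e.

Definition maximal_character tau :=
  is_character tau /\
  forall sigma, is_character sigma -> char_le tau sigma -> sigma = tau.

Definition spectrum : topologicalType :=
  [set tau : {ptws E -> bool} | maximal_character tau].

Definition char_val (tau : spectrum) : E -> bool := set_val tau.

Lemma char_valP (tau : spectrum) : maximal_character (char_val tau).
Proof. exact: set_valP. Qed.

Lemma char_val_inj : injective char_val.
Proof. by move=> tau sigma; exact: val_inj. Qed.

End Spectrum.

(* [gmul a b] is only meaningful when [gdom a = gran b]; all axioms,
   including continuity, are restricted to composable pairs. *)
Record topological_groupoid := TopologicalGroupoid {
  gobj : topologicalType;
  garr : topologicalType;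
  gdom : garr -> gobj;
  gran : garr -> gobj;
  gid : gobj -> garr;
  gmul : garr -> garr -> garr;
  ginv : garr -> garr;
  gdom_id : forall x, gdom (gid x) = x;
  gran_id : forall x, gran (gid x) = x;
  gdom_mul : forall a b, gdom a = gran b -> gdom (gmul a b) = gdom b;
  gran_mul : forall a b, gdom a = gran b -> gran (gmul a b) = gran a;
  gmulA : forall a b c, gdom a = gran b -> gdom b = gran c ->
    gmul a (gmul b c) = gmul (gmul a b) c;
  gmul_id : forall a, gmul a (gid (gdom a)) = a;
  gid_mul : forall a, gmul (gid (gran a)) a = a;
  gdom_inv : forall a, gdom (ginv a) = gran a;
  gran_inv : forall a, gran (ginv a) = gdom a;
  gmul_inv : forall a, gmul a (ginv a) = gid (gran a);
  ginv_mul : forall a, gmul (ginv a) a = gid (gdom a);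
  gdom_cont : continuous gdom;
  gran_cont : continuous gran;
  gid_cont : continuous gid;
  gmul_cont : {within [set p : garr * garr | gdom p.1 = gran p.2],
                continuous (fun p => gmul p.1 p.2)};
  ginv_cont : continuous ginv
}.

Definition continuous_functor (G H : topological_groupoid)
    (f0 : gobj G -> gobj H) (f1 : garr G -> garr H) :=
  [/\ continuous f0 /\ continuous f1,
      forall a, gdom (f1 a) = f0 (gdom a),
      forall a, gran (f1 a) = f0 (gran a),
      forall x, f1 (gid x) = gid (f0 x) &
      forall a b, gdom a = gran b -> f1 (gmul a b) = gmul (f1 a) (f1 b)].

Definition local_homeomorphism (X Y : topologicalType) (f : X -> Y) :=
  forall x, exists U : set X, [/\ open U, U x, open (f @` U) &
    exists g : Y -> X, [/\ {within U, continuous f},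
      {within f @` U, continuous g} & forall y, U y -> g (f y) = y]].

Definition boolean_space (X : topologicalType) :=
  hausdorff_space X /\ basis [set K : set X | compact K /\ open K].

Definition etale (G : topological_groupoid) := local_homeomorphism (@gdom G).

Definition ample (G : topological_groupoid) :=
  etale G /\ boolean_space (gobj G).

Record graded_groupoid (gT : groupType) := GradedGroupoid {
  gr_groupoid :> topological_groupoid;
  cocycle : garr gr_groupoid -> gT;
  cocycle_mul : forall a b, gdom a = gran b ->
    cocycle (gmul a b) = cocycle a * cocycle b;
  cocycle_cont : continuous (cocycle : _ -> discrete_topology gT)
}.

Definition graded_isomorphic (gT : groupType) (G H : graded_groupoid gT) :=
  exists (f0 : gobj G -> gobj H) (f1 : garr G -> garr H)
         (g0 : gobj H -> gobj G) (g1 : garr H -> garr G),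
    [/\ continuous_functor f0 f1, continuous_functor g0 g1,
        cancel f0 g0 /\ cancel g0 f0, cancel f1 g1 /\ cancel g1 f1 &
        forall a, cocycle (f1 a) = cocycle a].

(* [act s] is only meaningful on [adom s]; by [act_star] it is there a bijection
   onto [adom s^*] with inverse [act s^*].  [act_cover] says that the domains
   cover the space, so that every point carries an identity germ. *)
Record action (S : invSemigroup0Type) (X : topologicalType) := Action {
  adom : S -> set X;
  act : S -> X -> X;
  adom_open : forall s, open (adom s);
  act_cont : forall s, {within adom s, continuous (act s)};
  adom_mul : forall s t,
    adom (s * t) = [set x | adom t x /\ adom s (act t x)];
  act_mul : forall s t x, adom (s * t) x -> act (s * t) x = act s (act t x);
  act_star : forall s x, adom s x ->
    adom s^* (act s x) /\ act s^* (act s x) = x;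
  adom_zero : adom zero = set0;
  act_cover : forall x, exists s, adom s x
}.

Section ActionTheory.
Variables (S : invSemigroup0Type) (X : topologicalType) (a : action S X).
Implicit Types (s t u e f : S) (x y : X).

Lemma adom_source s : adom a (s^* * s) = adom a s.
Proof.
rewrite adom_mul; apply/seteqP; split=> x /=; first by case.
by move=> sx; split=> //; have [] := act_star sx.
Qed.

Lemma act_idem e x : e * e = e -> adom a e x -> act a e x = x.
Proof.
move=> ee ex; have [] := act_star ex; rewrite star_idem // => eex.
by rewrite -act_mul ee.
Qed.

Lemma adom_mul_idem s e x : e * e = e ->
  adom a (s * e) x <-> adom a e x /\ adom a s x.
Proof.
move=> ee; rewrite adom_mul /=.
by split=> -[ex sx]; split=> //; move: sx; rewrite (act_idem ee ex).
Qed.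

Lemma adom_ile s t x : ile s t -> adom a s x -> adom a t x.
Proof. by move=> [e ee ->] /(adom_mul_idem _ _ ee)[]. Qed.

Lemma act_ile s t x : ile s t -> adom a s x -> act a s x = act a t x.
Proof.
move=> [e ee ->] sx; have /(adom_mul_idem _ _ ee)[ex _] := sx.
by rewrite act_mul // (act_idem ee).
Qed.

Lemma act_cover_idem x : exists e, e * e = e /\ adom a e x.
Proof.
have [s sx] := act_cover a x; exists (s^* * s); split; first exact: star_mulP.
by rewrite adom_source.
Qed.

Lemma act_preimage_nbhs s x (V : set X) : adom a s x -> nbhs (act a s x) V ->
  nbhs x [set y | adom a s y /\ V (act a s y)].
Proof.
move=> sx Vsx; have os := adom_open a s.
have /(_ _ (mem_set sx) _ Vsx) h : {in adom a s, continuous (act a s)}.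
  by have := @act_cont _ _ a s; rewrite continuous_open_subspace.
by apply: (@filterI _ (nbhs x)); [exact: open_nbhs_nbhs | exact: h].
Qed.

End ActionTheory.

Section Germs.
Variables (S : invSemigroup0Type) (X : topologicalType) (a : action S X).

(* By [adom_source], [adom a s] is X_(s^* s). *)
Record germ_rep := GermRep {
  rep_elt : S;
  rep_pt : X;
  repP : adom a rep_elt rep_pt
}.

HB.instance Definition _ := gen_eqMixin germ_rep.
HB.instance Definition _ := gen_choiceMixin germ_rep.

Definition germ_rel (p q : germ_rep) : bool :=
  `[< rep_pt p = rep_pt q /\ exists u : S,
      [/\ ile u (rep_elt p), ile u (rep_elt q) & adom a u (rep_pt p)] >].

Lemma germ_rel_refl : reflexive germ_rel.
Proof.
move=> p; apply/asboolP; split=> //; exists (rep_elt p); split; try exact: ile_refl.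
exact: repP.
Qed.

Lemma germ_rel_sym : symmetric germ_rel.
Proof.
move=> p q; apply/asboolP/asboolP => -[e [u [up uq ux]]];
by split=> //; exists u; rewrite -?e // e.
Qed.

Lemma germ_rel_trans : transitive germ_rel.
Proof.
move=> q p r /asboolP[pq [u [up uq ux]]] /asboolP[qr [v [vq vr vx]]].
apply/asboolP; split; first by rewrite pq.
case: uq up ux vq vr => e ee -> up ux [f ff vE] vr.
rewrite vE in vr vx.
exists (rep_elt q * e * f); split.
- by apply: ile_trans up; exact: ile_mulr.
- rewrite -mulgA (idem_comm ee ff) mulgA; apply: ile_trans vr; exact: ile_mulr.
- apply/adom_mul_idem => //; split=> //; rewrite pq.
  by have /(adom_mul_idem _ _ _ ff)[] := vx.
Qed.

Definition germ_equiv := EquivRel germ_rel germ_rel_refl germ_rel_sym germ_rel_trans.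

Definition germs : Type := {eq_quot germ_equiv}.
HB.instance Definition _ := Choice.on germs.
HB.instance Definition _ := Quotient.on germs.

(* [germ sx] is the class [s, x], for [sx : adom a s x]. *)
Definition germ s x (sx : adom a s x) : germs := \pi_germs (GermRep sx).

Lemma germ_eq s t x y (sx : adom a s x) (ty : adom a t y) :
  germ sx = germ ty <->
  x = y /\ exists u, [/\ ile u s, ile u t & adom a u x].
Proof.
by split=> [/eqmodP/asboolP|] // h; apply/eqmodP/asboolP.
Qed.

Lemma germP (g : germs) : exists s x (sx : adom a s x), g = germ sx.
Proof.
elim/quotW: g => -[s x sx]; by exists s, x, sx.
Qed.

Definition germ_slice s (U : set X) : set germs :=
  [set g | exists x (sx : adom a s x), U x /\ g = germ sx].

Definition germ_basis : set (set germs) :=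
  [set A | exists s U, [/\ open U, U `<=` adom a s & A = germ_slice s U]].

Lemma germ_basis_cover : \bigcup_(A in germ_basis) A = setT.
Proof.
apply/seteqP; split=> // g _; have [s [x [sx ->]]] := germP g.
exists (germ_slice s (adom a s)); last by exists x, sx.
by exists s, (adom a s); split=> //; exact: adom_open.
Qed.

Lemma germ_basis_join (A B : set germs) g : germ_basis A -> germ_basis B ->
  A g -> B g -> exists C, [/\ germ_basis C, C g & C `<=` A `&` B].
Proof.
move=> [s [U [oU Us ->]]] [t [V [oV Vt ->]]] [x [sx [Ux ->]]] [y [ty [Vy]]].
move=> /germ_eq[xy [u [us ut ux]]]; subst y.
exists (germ_slice u (U `&` V `&` adom a u)); split.
- exists u, (U `&` V `&` adom a u); split=> //.
  by apply: openI; [exact: openI | exact: adom_open].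
- exists x, ux; split=> //; apply/germ_eq; split=> //.
  by exists u; split=> //; exact: ile_refl.
- move=> _ [z [uz [[[Uz Vz] _] ->]]]; split.
  + exists z, (Us _ Uz); split=> //; apply/germ_eq; split=> //.
    by exists u; split=> //; exact: ile_refl.
  + exists z, (Vt _ Vz); split=> //; apply/germ_eq; split=> //.
    by exists u; split=> //; exact: ile_refl.
Qed.

HB.instance Definition _ := @isBaseTopological.Build germs
  (set germs) germ_basis id germ_basis_cover germ_basis_join.

Lemma nbhs_germ s x (sx : adom a s x) (W : set germs) :
  nbhs (germ sx) W <->
  exists U : set X, [/\ nbhs x U & forall y (sy : adom a s y), U y -> W (germ sy)].
Proof.
split.
  move=> nW; rewrite nbhsE in nW; case: nW => [B [[D DB <-] [A DA As]] BW].
  have [t [V [oV Vt AE]]] := DB _ DA.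
  move: (As); rewrite AE => -[y [ty [Vy]]] /germ_eq[xy [u [us ut ux]]]; subst y.
  exists (V `&` adom a u); split.
    apply: open_nbhs_nbhs; split=> //; apply: openI => //; exact: adom_open.
  move=> z sz [Vz uz]; apply: BW; exists A => //=; rewrite AE.
  exists z, (Vt _ Vz); split=> //; apply/germ_eq; split=> //.
  by exists u.
move=> [U [Ux UW]]; move: Ux; rewrite nbhsE => -[U' [oU' U'x] U'U].
rewrite nbhsE; exists (germ_slice s (U' `&` adom a s)).
  split; last by exists x, sx.
  exists [set germ_slice s (U' `&` adom a s)].
    move=> _ ->; exists s, (U' `&` adom a s).
    by split=> //; apply: openI => //; exact: adom_open.
  by rewrite bigcup_set1.
by move=> _ [z [sz [[U'z _] ->]]]; apply: UW; exact: U'U.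
Qed.

Implicit Types (g h k : germs).

Lemma germ_irr s x y (sx : adom a s x) (sy : adom a s y) :
  x = y -> germ sx = germ sy.
Proof. by move=> xy; subst y; rewrite (Prop_irrelevance sx sy). Qed.

Lemma repr_germ g : germ (repP (repr g)) = g.
Proof. by rewrite -[RHS]reprK /germ; case: (repr g). Qed.

Definition germ_dom g : X := rep_pt (repr g).

Definition germ_ran g : X := act a (rep_elt (repr g)) (rep_pt (repr g)).

Lemma germ_domE s x (sx : adom a s x) : germ_dom (germ sx) = x.
Proof. by have /germ_eq[] := repr_germ (germ sx). Qed.

Lemma germ_ranE s x (sx : adom a s x) : germ_ran (germ sx) = act a s x.
Proof.
have /germ_eq[/= e [u [us ut ux]]] := repr_germ (germ sx).
rewrite /germ_ran -(act_ile us ux) e; apply: act_ile ut _.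
by rewrite -e.
Qed.

Definition germ_id x : germs := germ (projT2 (cid (act_cover_idem a x))).2.

Lemma germ_idE e x (ex : adom a e x) : e * e = e -> germ_id x = germ ex.
Proof.
move=> ee; rewrite /germ_id; case: cid => f [ff fx] /=.
apply/germ_eq; split=> //; exists (f * e); split.
- exact: ile_mulr.
- exact: ile_mull.
- exact/(adom_mul_idem _ _ _ ee).
Qed.

Definition germ_inv g : germs := germ (act_star (repP (repr g))).1.

Lemma germ_invE s x (sx : adom a s x) : germ_inv (germ sx) = germ (act_star sx).1.
Proof.
have /germ_eq[/= e [u [us ut ux]]] := repr_germ (germ sx).
have ux' : adom a u x by rewrite -e.
apply/germ_eq; split; first by rewrite -(act_ile us ux) e; exact: act_ile.
exists u^*; split; try exact: ile_star.
by rewrite -(act_ile us ux); have [] := act_star ux.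
Qed.

(* The last branch is only taken for non-composable pairs, see [germ_mulE]. *)
Definition germ_mul g h : germs :=
  let p := repr g in let q := repr h in
  if pselect (adom a (rep_elt p * rep_elt q) (rep_pt q)) is left pq
  then germ pq else g.

Lemma adom_mulP s t x : adom a t x -> adom a s (act a t x) -> adom a (s * t) x.
Proof. by move=> tx stx; rewrite adom_mul. Qed.

Lemma germ_mulE s t x (tx : adom a t x) (stx : adom a s (act a t x)) :
  germ_mul (germ stx) (germ tx) = germ (adom_mulP tx stx).
Proof.
rewrite /germ_mul.
have /germ_eq[/= e [u [us ut ux]]] := repr_germ (germ stx).
have /germ_eq[/= f [v [vs vt vx]]] := repr_germ (germ tx).
set p := repr (germ stx) in e us ux *; set q := repr (germ tx) in f vs vx *.
have uvx : adom a (u * v) (rep_pt q).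
  rewrite adom_mul; split=> //=.
  by rewrite f (act_ile vt) -?e // -f.
have le1 : ile (u * v) (rep_elt p * rep_elt q) by exact: ile_mul.
have le2 : ile (u * v) (s * t) by exact: ile_mul.
case: pselect => [pq|]; last by case; exact: adom_ile le1 uvx.
by apply/germ_eq; split=> //; exists (u * v).
Qed.

Lemma composable_germP g h : germ_dom g = germ_ran h ->
  exists s t x (tx : adom a t x) (stx : adom a s (act a t x)),
    g = germ stx /\ h = germ tx.
Proof.
have [s [y [sy ->]]] := germP g; have [t [x [tx ->]]] := germP h.
rewrite germ_domE germ_ranE => yE; subst y.
by exists s, t, x, tx, sy.
Qed.

Lemma germ_dom_id x : germ_dom (germ_id x) = x.
Proof. by rewrite germ_domE. Qed.

Lemma germ_ran_id x : germ_ran (germ_id x) = x.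
Proof. by rewrite /germ_id; case: cid => e [ee ex] /=; rewrite germ_ranE act_idem. Qed.

Lemma germ_dom_mul g h : germ_dom g = germ_ran h ->
  germ_dom (germ_mul g h) = germ_dom h.
Proof.
by move=> /composable_germP[s [t [x [tx [stx [-> ->]]]]]]; rewrite germ_mulE !germ_domE.
Qed.

Lemma germ_ran_mul g h : germ_dom g = germ_ran h ->
  germ_ran (germ_mul g h) = germ_ran g.
Proof.
move=> /composable_germP[s [t [x [tx [stx [-> ->]]]]]]; rewrite germ_mulE !germ_ranE.
by rewrite act_mul //; exact: adom_mulP.
Qed.

Lemma germ_mulA g h k : germ_dom g = germ_ran h -> germ_dom h = germ_ran k ->
  germ_mul g (germ_mul h k) = germ_mul (germ_mul g h) k.
Proof.
move=> gh /composable_germP[t [w [x [wx [twx [hE kE]]]]]]; move: gh; rewrite hE kE.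
have [s [y [sy ->]]] := germP g; rewrite germ_domE germ_ranE => yE; subst y.
rewrite !germ_mulE.
have sy' : adom a s (act a (t * w) x) by rewrite act_mul //; exact: adom_mulP.
have -> : germ sy = germ sy' by apply: germ_irr; rewrite act_mul //; exact: adom_mulP.
rewrite germ_mulE; apply/germ_eq; split=> //; exists (s * (t * w)).
split; [exact: ile_refl | by rewrite mulgA; exact: ile_refl |].
exact: adom_mulP (adom_mulP wx twx) sy'.
Qed.

Lemma germ_mul_id g : germ_mul g (germ_id (germ_dom g)) = g.
Proof.
have [s [x [sx ->]]] := germP g; rewrite germ_domE.
have [e [ee ex]] := act_cover_idem a x; rewrite (germ_idE ex ee).
have sex : adom a s (act a e x) by rewrite act_idem.
rewrite (germ_irr sx sex) ?act_idem // germ_mulE; apply/germ_eq.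
rewrite act_idem //; split=> //; exists (s * e).
by split; [exact: ile_refl | exact: ile_mulr | exact: adom_mulP].
Qed.

Lemma germ_id_mul g : germ_mul (germ_id (germ_ran g)) g = g.
Proof.
have [s [x [sx ->]]] := germP g; rewrite germ_ranE.
have [e [ee ex]] := act_cover_idem a (act a s x); rewrite (germ_idE ex ee) germ_mulE.
apply/germ_eq; split=> //; exists (e * s).
by split; [exact: ile_refl | exact: ile_mull | exact: adom_mulP].
Qed.

Lemma germ_dom_inv g : germ_dom (germ_inv g) = germ_ran g.
Proof. by have [s [x [sx ->]]] := germP g; rewrite germ_invE germ_domE germ_ranE. Qed.

Lemma germ_ran_inv g : germ_ran (germ_inv g) = germ_dom g.
Proof.
have [s [x [sx ->]]] := germP g; rewrite germ_invE germ_domE germ_ranE.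
by have [] := act_star sx.
Qed.

Lemma germ_inv_mul g : germ_mul (germ_inv g) g = germ_id (germ_dom g).
Proof.
have [s [x [sx ->]]] := germP g; rewrite germ_invE germ_domE germ_mulE.
by symmetry; apply: germ_idE; exact: star_mulP.
Qed.

Lemma germ_mul_inv g : germ_mul g (germ_inv g) = germ_id (germ_ran g).
Proof.
have [s [x [sx ->]]] := germP g; rewrite germ_invE germ_ranE.
have [sy e] := act_star sx.
have sx' : adom a s (act a s^* (act a s x)) by rewrite e.
rewrite (germ_irr sx sx') // germ_mulE.
by symmetry; apply: germ_idE; exact: mul_starP.
Qed.

Lemma germ_dom_cont : continuous germ_dom.
Proof.
move=> g; have [s [x [sx ->]]] := germP g; move=> V; rewrite germ_domE => Vx.
by apply/nbhs_germ; exists V; split=> // y sy; rewrite /= germ_domE.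
Qed.

Lemma germ_ran_cont : continuous germ_ran.
Proof.
move=> g; have [s [x [sx ->]]] := germP g; move=> V; rewrite germ_ranE => Vx.
apply/nbhs_germ; exists [set y | adom a s y /\ V (act a s y)].
split; first exact: act_preimage_nbhs.
by move=> y sy [_ Vy]; rewrite /= germ_ranE.
Qed.

Lemma germ_id_cont : continuous germ_id.
Proof.
move=> x V; have [e [ee ex]] := act_cover_idem a x.
rewrite (germ_idE ex ee) => /nbhs_germ[U [Ux UV]].
have nex : nbhs x (adom a e) by apply: open_nbhs_nbhs; split=> //; exact: adom_open.
apply: filterS (filterI nex Ux) => y [ey Uy] /=.
by rewrite (germ_idE ey ee); exact: UV.
Qed.

Lemma germ_inv_cont : continuous germ_inv.
Proof.
move=> g; have [s [x [sx ->]]] := germP g; move=> V.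
rewrite germ_invE => /nbhs_germ[U [Ux UV]].
apply/nbhs_germ; exists [set y | adom a s y /\ U (act a s y)].
split; first exact: act_preimage_nbhs.
by move=> y sy [_ Uy]; rewrite /= germ_invE; exact: UV.
Qed.

Lemma germ_mul_cont :
  {within [set p : germs * germs | germ_dom p.1 = germ_ran p.2],
    continuous (fun p => germ_mul p.1 p.2)}.
Proof.
apply/subspace_continuousP => -[g h] /composable_germP.
move=> [s [t [x [tx [stx [/= -> ->]]]]]] V nV.
have {nV} : nbhs (germ_mul (germ stx) (germ tx)) V by exact: nV.
rewrite germ_mulE => /nbhs_germ[U [Ux UV]]; rewrite /within /=.
pose A := [set g | exists y (sy : adom a s y), g = germ sy].
pose B := [set g | exists y (ty : adom a t y), U y /\ g = germ ty].
exists (A, B) => /=.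
  split; apply/nbhs_germ.
    by exists setT; split=> [|y sy _]; [exact: filterT | exists y, sy].
  by exists U; split=> // y ty Uy; exists y, ty.
move=> [_ _] [/= [y [sy ->]] [z [tz [Uz ->]]]].
rewrite germ_domE germ_ranE => yE; subst y.
by have := UV _ (adom_mulP tz sy) Uz; rewrite -germ_mulE.
Qed.

Definition germ_groupoid : topological_groupoid :=
  @TopologicalGroupoid X germs germ_dom germ_ran germ_id germ_mul germ_inv
    germ_dom_id germ_ran_id germ_dom_mul germ_ran_mul germ_mulA
    germ_mul_id germ_id_mul germ_dom_inv germ_ran_inv germ_mul_inv germ_inv_mul
    germ_dom_cont germ_ran_cont germ_id_cont germ_mul_cont germ_inv_cont.

End Germs.

(* The value of [deg] at [zero] is arbitrary. *)
Record grading (gT : groupType) (S : invSemigroup0Type) := Grading {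
  deg :> S -> gT;
  deg_mul : forall s t, s * t <> zero -> deg (s * t) = deg s * deg t
}.

Section GradedGerms.
Variables (gT : groupType) (S : invSemigroup0Type) (theta : grading gT S).
Variables (X : topologicalType) (a : action S X).

Lemma adom_neq0 (s : S) x : adom a s x -> s <> zero.
Proof. by move=> + s0; rewrite s0 adom_zero. Qed.

Lemma deg_idem (e : S) : e * e = e -> e <> zero -> theta e = 1.
Proof.
move=> ee e0; have := @deg_mul _ _ theta e e; rewrite ee => /(_ e0) h.
by apply: (mulgI (theta e)); rewrite -h mulg1.
Qed.

Lemma deg_ile (s t : S) : ile s t -> s <> zero -> theta s = theta t.
Proof.
move=> [e ee ->] te0; rewrite deg_mul // (deg_idem ee) ?mulg1 // => e0.
by apply: te0; rewrite e0 muls0.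
Qed.

Definition germ_deg (g : germs a) : gT := theta (rep_elt (repr g)).

Lemma germ_degE s x (sx : adom a s x) : germ_deg (germ sx) = theta s.
Proof.
have /germ_eq[_ [u [us ut ux]]] := repr_germ (germ sx).
have u0 := adom_neq0 ux.
by rewrite /germ_deg -(deg_ile us) // (deg_ile ut).
Qed.

Lemma germ_deg_mul (g h : germs a) : germ_dom g = germ_ran h ->
  germ_deg (germ_mul g h) = germ_deg g * germ_deg h.
Proof.
move=> /composable_germP[s [t [x [tx [stx [-> ->]]]]]].
by rewrite germ_mulE !germ_degE deg_mul //; exact: adom_neq0 (adom_mulP tx stx).
Qed.

Lemma germ_deg_cont : continuous (germ_deg : _ -> discrete_topology gT).
Proof.
move=> g; have [s [x [sx ->]]] := germP g; move=> V.
rewrite germ_degE => /nbhs_singleton Vs.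
apply/nbhs_germ; exists setT; split; first exact: filterT.
by move=> y sy _; rewrite /= germ_degE.
Qed.

Definition graded_germ_groupoid : graded_groupoid gT :=
  @GradedGroupoid gT (germ_groupoid a) germ_deg germ_deg_mul germ_deg_cont.

End GradedGerms.

Section SpectralAction.
Variable S : invSemigroup0Type.
Local Notation E := (idempotents S).
Implicit Types (s t : S) (e f : E).

Lemma idem_conjP s e : (s^* * val e * s) * (s^* * val e * s) == s^* * val e * s.
Proof. by apply/eqP/conj_idem; exact: idemE. Qed.
Definition idem_conj s e : E := Idempotent (idem_conjP s e).

Lemma idem_sourceP s : (s^* * s) * (s^* * s) == s^* * s.
Proof. by apply/eqP; exact: star_mulP. Qed.
Definition idem_source s : E := Idempotent (idem_sourceP s).

Definition spectrum_dom s : set (spectrum E) :=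
  [set tau : spectrum E | char_val tau (idem_source s)].

Definition char_act s (tau : E -> bool) : E -> bool := tau \o idem_conj s.

Lemma char_mul (tau : E -> bool) e f : is_character tau ->
  tau (idem_meet e f) = tau e && tau f.
Proof. by move=> [_ _ h]; exact: h. Qed.

Lemma char_act_character s tau : is_character tau -> tau (idem_source s) ->
  is_character (char_act s tau).
Proof.
move=> ct ts; split.
- exists (idem_source s^*); rewrite /char_act /= (_ : idem_conj _ _ = idem_source s) //.
  by apply: val_inj => /=; rewrite starK !mulgA star_mulK.
- have [_ t0 _] := ct; rewrite /char_act /= -t0; congr tau.
  by apply: val_inj => /=; rewrite muls0 mul0s.
- move=> e f; rewrite /char_act /= -char_mul //; congr tau.
  apply: val_inj => /=; transitivity (s^* * val e * (s * s^* * val f) * s).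
    have <- : val f * (s * s^* ) = s * s^* * val f.
      by apply: idem_comm; [exact: idemE | exact: mul_starP].
    transitivity (s^* * val e * val f * (s * s^* * s)).
      by rewrite mul_starK !mulgA.
    by rewrite !mulgA.
  by rewrite !mulgA.
Qed.

Lemma char_actK s tau e : is_character tau -> tau (idem_source s) ->
  char_act s^* (char_act s tau) e = tau e.
Proof.
move=> ct ts; transitivity (tau (idem_meet (idem_meet (idem_source s) e) (idem_source s))).
  by congr tau; apply: val_inj => /=; rewrite starK !mulgA.
by rewrite !char_mul // ts andbT.
Qed.

Lemma char_act_dom s tau : is_character tau -> tau (idem_source s) ->
  char_act s tau (idem_source s^* ).
Proof.
move=> ct ts; rewrite /char_act /= (_ : idem_conj _ _ = idem_source s) //.
by apply: val_inj => /=; rewrite starK !mulgA star_mulK.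
Qed.

Lemma char_act_maximal s tau : maximal_character tau -> tau (idem_source s) ->
  maximal_character (char_act s tau).
Proof.
move=> [ct mt] ts; split; first exact: char_act_character.
move=> sigma csigma le.
have ss : sigma (idem_source s^* ) by apply: le; exact: char_act_dom.
have h : char_act s^* sigma = tau.
  apply: mt; first exact: char_act_character.
  by move=> e te; apply: le; rewrite -(char_actK e ct ts) in te.
by rewrite -h; apply/funext => e; rewrite -{1}(char_actK e csigma ss) starK.
Qed.

Definition spectrum_act s (tau : spectrum E) : spectrum E :=
  if pselect (spectrum_dom s tau) is left ts
  then exist _ (char_act s (char_val tau))
         (mem_set (char_act_maximal (char_valP tau) ts)) : spectrum E
  else tau.

Lemma spectrum_actE s (tau : spectrum E) : spectrum_dom s tau ->
  char_val (spectrum_act s tau) = char_act s (char_val tau).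
Proof. by rewrite /spectrum_act; case: pselect. Qed.

Lemma spectrum_eval_cont e : continuous (fun tau : spectrum E => char_val tau e).
Proof.
move=> tau; apply: (@continuous_comp _ {ptws E -> bool} _
  (fun sigma : spectrum E => char_val sigma) (@^~ e)).
  exact: initial_continuous.
exact: (@proj_continuous E (fun=> bool) e).
Qed.

Lemma spectrum_dom_open s : open (spectrum_dom s).
Proof.
have := (continuousP _).1 (@spectrum_eval_cont (idem_source s)) [set true].
by apply; exact: discrete_open.
Qed.

Lemma spectrum_cvg (F : set_system (spectrum E)) (tau : spectrum E) : Filter F ->
  (forall e, (fun sigma : spectrum E => char_val sigma e) @ F --> char_val tau e) ->
  F --> tau.
Proof.
move=> FF h A [_ [[B oB <-] Btau BA]].
have {}h : (fun sigma : spectrum E => char_val sigma) @ F -->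
    (char_val tau : {ptws E -> bool}).
  apply/cvg_sup => e W [_ [[O oO <-] /= Oe] OW].
  apply: (@filterS _ F _ _ _ _ (h e O _)) => [sigma Os|].
    exact: OW.
  exact: open_nbhs_nbhs.
apply: filterS BA _; apply: h; exact: open_nbhs_nbhs.
Qed.

Lemma spectrum_act_cont s : {within spectrum_dom s, continuous (spectrum_act s)}.
Proof.
rewrite continuous_open_subspace; last exact: spectrum_dom_open.
move=> tau /set_mem ts; apply: spectrum_cvg => [|e].
  by apply: fmap_filter; exact: (nbhs_filter tau).
rewrite spectrum_actE // => V /= Vt.
have := @spectrum_eval_cont (idem_conj s e) tau V Vt.
have := open_nbhs_nbhs (conj (spectrum_dom_open s) ts).
move=> n1 n2; apply: filterS (filterI n1 n2) => sigma [/= d1 d2].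
by rewrite /= spectrum_actE.
Qed.

Lemma spectrum_dom_mul s t : spectrum_dom (s * t) =
  [set tau | spectrum_dom t tau /\ spectrum_dom s (spectrum_act t tau)].
Proof.
apply/seteqP; split=> tau.
  move=> st; have tt : spectrum_dom t tau.
    move: st; rewrite /spectrum_dom /=.
    rewrite (_ : idem_source (s * t) = idem_meet (idem_source (s * t)) (idem_source t)).
      by rewrite char_mul => [/andP[]//|]; have [] := char_valP tau.
    apply: val_inj; rewrite /= star_mul.
    transitivity (t^* * s^* * s * (t * t^* * t)); last by rewrite !mulgA.
    by rewrite mul_starK !mulgA.
  split=> //; rewrite /spectrum_dom /= spectrum_actE // /char_act /=.
  move: st; rewrite /spectrum_dom /=; congr (is_true (char_val tau _)).
  by apply: val_inj; rewrite /= star_mul !mulgA.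
move=> [/= tt]; rewrite /spectrum_dom /= spectrum_actE // /char_act /=.
congr (is_true (char_val tau _)).
by apply: val_inj; rewrite /= star_mul !mulgA.
Qed.

Lemma spectrum_act_mul s t tau : spectrum_dom (s * t) tau ->
  spectrum_act (s * t) tau = spectrum_act s (spectrum_act t tau).
Proof.
move=> st; have := st; rewrite spectrum_dom_mul => -[/= tt sst].
apply: char_val_inj; rewrite !spectrum_actE //; apply/funext => e.
by congr (char_val tau _); apply: val_inj; rewrite /= star_mul !mulgA.
Qed.

Lemma spectrum_act_star s tau : spectrum_dom s tau ->
  spectrum_dom s^* (spectrum_act s tau) /\
  spectrum_act s^* (spectrum_act s tau) = tau.
Proof.
move=> ts; have [ct _] := char_valP tau.
have ds : spectrum_dom s^* (spectrum_act s tau).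
  by rewrite /spectrum_dom /= spectrum_actE //; exact: char_act_dom.
split=> //; apply: char_val_inj; rewrite !spectrum_actE //; apply/funext => e.
exact: char_actK.
Qed.

Lemma spectrum_dom_zero : spectrum_dom zero = set0.
Proof.
apply/seteqP; split=> // tau; rewrite /spectrum_dom /=.
have [[_ t0 _] _] := char_valP tau; rewrite (_ : idem_source zero = \bot%O) ?t0 //.
by apply: val_inj; rewrite /= muls0.
Qed.

Lemma spectrum_cover tau : exists s, spectrum_dom s tau.
Proof.
have [[[e te] _ _] _] := char_valP tau; exists (val e); rewrite /spectrum_dom /=.
rewrite (_ : idem_source (val e) = e) //; apply: val_inj => /=.
by rewrite star_idem idemE.
Qed.

Definition spectral_action : action S (spectrum E) :=
  Action spectrum_dom_open spectrum_act_cont spectrum_dom_mul spectrum_act_mul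
    spectrum_act_star spectrum_dom_zero spectrum_cover.

End SpectralAction.

Section GroupoidTheory.
Variable G : topological_groupoid.
Implicit Types a b c : garr G.

Lemma gmulK a b : gdom a = gran b -> gmul (ginv a) (gmul a b) = b.
Proof.
by move=> ab; rewrite gmulA ?gdom_inv // ginv_mul ab gid_mul.
Qed.

Lemma gmulVK a b : gran a = gran b -> gmul a (gmul (ginv a) b) = b.
Proof.
by move=> ab; rewrite gmulA ?gran_inv ?gdom_inv // gmul_inv ab gid_mul.
Qed.

Lemma gmulKr a b : gdom a = gran b -> gmul (gmul a b) (ginv b) = a.
Proof.
by move=> ab; rewrite -gmulA ?gran_inv // gmul_inv -ab gmul_id.
Qed.

Lemma gid_inv a : gmul a a = a -> gdom a = gran a -> a = gid (gdom a).
Proof. by move=> aa da; rewrite -{1}(gmulK da) aa ginv_mul. Qed.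

Lemma ginv_uniq a b : gdom a = gran b -> gmul a b = gid (gdom b) -> a = ginv b.
Proof.
move=> ab e; have := gmulKr ab; rewrite e => <-.
by rewrite -[gdom b]gran_inv gid_mul.
Qed.

Lemma ginvK a : ginv (ginv a) = a.
Proof. by symmetry; apply: ginv_uniq; rewrite ?gran_inv // gmul_inv gdom_inv. Qed.

Lemma ginvM a b : gdom a = gran b -> ginv (gmul a b) = gmul (ginv b) (ginv a).
Proof.
move=> ab; symmetry; apply: ginv_uniq.
  by rewrite gdom_mul ?gdom_inv ?gran_inv // gran_mul.
rewrite gdom_mul // -gmulA ?gmulK ?ginv_mul //.
  by rewrite gdom_inv gran_inv.
by rewrite gdom_inv gran_mul.
Qed.

Definition gset_mul (U V : set (garr G)) : set (garr G) :=
  [set c | exists a b, [/\ U a, V b, gdom a = gran b & c = gmul a b]].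

Definition gset_inv (U : set (garr G)) : set (garr G) := [set ginv a | a in U].

Definition local_bisection (U : set (garr G)) :=
  [/\ open U, set_inj U (@gdom G) & set_inj U (@gran G)].

End GroupoidTheory.

Lemma local_homeo_open (X Y : topologicalType) (f : X -> Y) (W : set X) :
  local_homeomorphism f -> open W -> open (f @` W).
Proof.
move=> lf oW; rewrite openE => _ [x Wx <-].
have [U [oU Ux ofU [g [_ cg gf]]]] := lf x.
have {}cg : {in f @` U, continuous g}.
  by move: cg; rewrite continuous_open_subspace.
have gfx : g (f x) = x by exact: gf.
have n1 : nbhs (f x) (f @` U) by apply: open_nbhs_nbhs; split=> //; exists x.
have n2 : nbhs (f x) (g @^-1` W).
  apply: (cg (f x)); first by apply: mem_set; exists x.
  by rewrite gfx; exact: open_nbhs_nbhs.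
apply: filterS (filterI n1 n2) => _ [[z Uz <-] /=]; rewrite gf // => Wz.
by exists z.
Qed.

Section EtaleTheory.
Variable G : topological_groupoid.

Lemma gset_inv_preim (U : set (garr G)) : gset_inv U = @ginv G @^-1` U.
Proof.
apply/seteqP; split=> [_ [a Ua <-] /=|a /= Ua]; first by rewrite ginvK.
by exists (ginv a) => //; rewrite ginvK.
Qed.

Lemma gset_inv_open (U : set (garr G)) : open U -> open (gset_inv U).
Proof. by rewrite gset_inv_preim; apply: ((continuousP _).1 (@ginv_cont G)). Qed.

Lemma etale_ran_open (U : set (garr G)) : etale G -> open U -> open (@gran G @` U).
Proof.
move=> eG oU; rewrite (_ : _ @` U = @gdom G @` gset_inv U).
  by apply: local_homeo_open => //; exact: gset_inv_open.
apply/seteqP; split=> [_ [a Ua <-]|_ [_ [a Ua <-] <-]].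
  by exists (ginv a); [exists a | rewrite gdom_inv].
by exists a => //; rewrite gdom_inv.
Qed.

Lemma gset_mul_open (U V : set (garr G)) : etale G -> open U -> open V ->
  open (gset_mul U V).
Proof.
move=> eG oU oV; rewrite openE => _ [a [b [Ua Vb ab ->]]].
have comp : [set p : garr G * garr G | gdom p.1 = gran p.2] (ginv a, gmul a b).
  by rewrite /= gdom_inv gran_mul.
have nV : nbhs (gmul (ginv a) (gmul a b)) V.
  by rewrite gmulK //; exact: open_nbhs_nbhs.
have := (subspace_continuousP _ _).1 (@gmul_cont G) _ comp V nV.
rewrite /within /= => -[[N1 N2] /= [n1 n2] N12].
have := @ginv_cont G a N1 n1; rewrite nbhs_filterE nbhsE => -[M [oM Ma] MN].
have nr : nbhs (gmul a b) (@gran G @^-1` (@gran G @` (U `&` M))).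
  apply: (@gran_cont G); rewrite gran_mul //; apply: open_nbhs_nbhs; split.
    by apply: etale_ran_open => //; exact: openI.
  by exists a.
apply: filterS (filterI n2 nr) => c [N2c [a' [Ua' Ma'] /= a'c]].
exists a', (gmul (ginv a') c); split=> //.
- by apply: (N12 (ginv a', c)); [split=> //; exact: MN | rewrite /= gdom_inv].
- by rewrite gran_mul ?gran_inv ?gdom_inv.
- by rewrite gmulVK.
Qed.

Lemma composable_closed : hausdorff_space (gobj G) ->
  closed [set p : garr G * garr G | gdom p.1 = gran p.2].
Proof.
move=> hG [a b] cl /=; apply: hG => A B nA nB.
have nAB : nbhs (a, b) ([set p | A (gdom p.1)] `&` [set p | B (gran p.2)]).
  exists (@gdom G @^-1` A, @gran G @^-1` B) => //=.
  by split; [exact: (@gdom_cont G) | exact: (@gran_cont G)].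
have [[c d] [/= e [Ac Bd]]] := cl _ nAB.
by exists (gdom c); split=> //; rewrite e.
Qed.

Lemma gset_mul_compact (U V : set (garr G)) : hausdorff_space (gobj G) ->
  compact U -> compact V -> compact (gset_mul U V).
Proof.
move=> hG cU cV; set C := [set p : garr G * garr G | gdom p.1 = gran p.2].
rewrite (_ : gset_mul U V = (fun p => gmul p.1 p.2) @` ((U `*` V) `&` C)).
  apply: continuous_compact.
    by apply: continuous_subspaceW (@gmul_cont G) => p [].
  by apply: compact_closedI; [exact: compact_setX | exact: composable_closed].
apply/seteqP; split=> [_ [a [b [Ua Vb ab ->]]]|_ [[a b] [[/= Ua Vb] ab] <-]].
  by exists (a, b).
by exists a, b.
Qed.

Lemma gset_inv_compact (U : set (garr G)) : compact U -> compact (gset_inv U).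
Proof.
move=> cU; apply: continuous_compact => //.
by apply: continuous_subspaceT; exact: (@ginv_cont G).
Qed.

Lemma gset_mulA (U V W : set (garr G)) :
  gset_mul U (gset_mul V W) = gset_mul (gset_mul U V) W.
Proof.
apply/seteqP; split.
  move=> _ [a [_ [Ua [b [c [Vb Wc bc ->]]] abc ->]]].
  rewrite gran_mul // in abc; exists (gmul a b), c; split=> //.
  - by exists a, b.
  - by rewrite gdom_mul.
  - by rewrite gmulA.
move=> _ [_ [c [[a [b [Ua Vb ab ->]]] Wc abc ->]]].
rewrite gdom_mul // in abc; exists a, (gmul b c); split=> //.
- by exists b, c.
- by rewrite gran_mul.
- by rewrite gmulA.
Qed.

Lemma local_bisection_mul (U V : set (garr G)) : etale G ->
  local_bisection U -> local_bisection V -> local_bisection (gset_mul U V).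
Proof.
move=> eG [oU dU rU] [oV dV rV]; split; first exact: gset_mul_open.
- move=> _ _ /set_mem[a [b [Ua Vb ab ->]]] /set_mem[a' [b' [Ua' Vb' ab' ->]]].
  rewrite !gdom_mul // => e; have bb : b = b' by apply: dV => //; exact: mem_set.
  by subst b'; congr gmul; apply: dU; rewrite ?ab ?ab' //; exact: mem_set.
- move=> _ _ /set_mem[a [b [Ua Vb ab ->]]] /set_mem[a' [b' [Ua' Vb' ab' ->]]].
  rewrite !gran_mul // => e; have aa : a = a' by apply: rU => //; exact: mem_set.
  by subst a'; congr gmul; apply: rV; rewrite -?ab -?ab' //; exact: mem_set.
Qed.

Lemma local_bisection_inv (U : set (garr G)) :
  local_bisection U -> local_bisection (gset_inv U).
Proof.
move=> [oU dU rU]; split; first exact: gset_inv_open.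
- move=> _ _ /set_mem[a Ua <-] /set_mem[b Ub <-]; rewrite !gdom_inv => e.
  by congr ginv; apply: rU => //; exact: mem_set.
- move=> _ _ /set_mem[a Ua <-] /set_mem[b Ub <-]; rewrite !gran_inv => e.
  by congr ginv; apply: dU => //; exact: mem_set.
Qed.

Lemma gset_mul_invK (U : set (garr G)) : local_bisection U ->
  gset_mul (gset_mul U (gset_inv U)) U = U.
Proof.
move=> [_ dU rU]; apply/seteqP; split; last first.
  move=> a Ua; exists (gmul a (ginv a)), a; split=> //.
  - by exists a, (ginv a); split=> //; [exists a | rewrite gran_inv].
  - by rewrite gdom_mul ?gran_inv // gdom_inv.
  - by rewrite gmul_inv gid_mul.
move=> _ [_ [c [[a [_ [Ua [b Ub <-] ab ->]]] Uc abc ->]]].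
rewrite gran_inv in ab; rewrite gdom_mul ?gran_inv // gdom_inv in abc.
have e1 : a = b by apply: dU => //; exact: mem_set.
have e2 : b = c by apply: rU => //; exact: mem_set.
by subst c b; rewrite gmul_inv gid_mul.
Qed.

Lemma gset_invK (U : set (garr G)) : gset_inv (gset_inv U) = U.
Proof. by rewrite !gset_inv_preim; apply/funext => a; rewrite /preimage /= ginvK. Qed.

Lemma gset_mul_weak_inverse (U V : set (garr G)) : local_bisection V ->
  gset_mul (gset_mul V U) V = V -> V `<=` gset_inv U.
Proof.
move=> [_ dV rV] VUV b Vb; rewrite gset_inv_preim /=.
have := Vb; rewrite -{1}VUV => -[_ [b2 [[b1 [a [V1 Ua e1 ->]]] V2 e2 e]]].
have eb1 : b1 = b.
  by apply: rV; [exact: mem_set | exact: mem_set | rewrite e !gran_mul].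
have eb2 : b2 = b.
  by apply: dV; [exact: mem_set | exact: mem_set | rewrite e gdom_mul].
subst b1 b2; suff <- : a = ginv b by [].
have := gmulKr e2; rewrite -e => ba.
by rewrite -(gmulK e1) -ba gmulK // gran_inv.
Qed.

End EtaleTheory.

Section Bisections.
Variables (gT : groupType) (G : graded_groupoid gT).

Definition homogeneous (U : set (garr G)) :=
  exists g : gT, U `<=` @cocycle gT G @^-1` [set g].

Definition hc_bisection (U : set (garr G)) :=
  [/\ local_bisection U, compact U & homogeneous U].

Lemma cocycle_id x : cocycle (gid x : garr G) = 1.
Proof.
have e : gmul (gid x) (gid x) = gid x :> garr G.
  by rewrite -{2}(gdom_id x) gmul_id.
apply: (mulgI (cocycle (gid x : garr G))).
by rewrite -cocycle_mul ?gdom_id ?gran_id // e mulg1.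
Qed.

Lemma cocycle_inv (a : garr G) : cocycle (ginv a) = (cocycle a)^-1.
Proof.
apply: (mulgI (cocycle a)).
by rewrite -cocycle_mul ?gran_inv // gmul_inv cocycle_id mulgV.
Qed.

Lemma hc_bisection_mul U V : ample G -> hc_bisection U -> hc_bisection V ->
  hc_bisection (gset_mul U V).
Proof.
move=> [eG [hG _]] [bU cU [g Ug]] [bV cV [h Vh]]; split.
- exact: local_bisection_mul.
- exact: gset_mul_compact.
- exists (g * h) => _ [a [b [Ua Vb ab ->]]].
  by rewrite /= cocycle_mul // (Ug _ Ua) (Vh _ Vb).
Qed.

Lemma hc_bisection_inv U : hc_bisection U -> hc_bisection (gset_inv U).
Proof.
move=> [bU cU [g Ug]]; split.
- exact: local_bisection_inv.
- exact: gset_inv_compact.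
- by exists g^-1 => _ [a Ua <-]; rewrite /= cocycle_inv (Ug _ Ua).
Qed.

Lemma hc_bisection0 : hc_bisection set0.
Proof.
split; [split; first exact: open0| exact: compact0 |by exists 1].
- by move=> a b /set_mem.
- by move=> a b /set_mem.
Qed.

Record bisection := Bisection {
  bis_set :> set (garr G);
  bisP : hc_bisection bis_set
}.

HB.instance Definition _ := gen_eqMixin bisection.
HB.instance Definition _ := gen_choiceMixin bisection.

Lemma bis_inj (U V : bisection) : bis_set U = bis_set V -> U = V.
Proof.
case: U V => [U hU] [V hV] /= e; subst V.
by rewrite (Prop_irrelevance hU hV).
Qed.

End Bisections.

Section BisectionSemigroup.
Variables (gT : groupType) (G : graded_groupoid gT) (aG : ample G).

(* Ampleness is what makes these bisections closed under product. *)
Definition bisections (_ : ample G) : Type := bisection G.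
HB.instance Definition _ := Choice.on (bisections aG).

Implicit Types U V W : bisections aG.

Definition bis_mul U V : bisections aG := Bisection (hc_bisection_mul aG (bisP U) (bisP V)).
Definition bis_inv U : bisections aG := Bisection (hc_bisection_inv (bisP U)).
Definition bis_zero : bisections aG := Bisection (hc_bisection0 G).

Lemma bis_mulA : associative bis_mul.
Proof. by move=> U V W; apply: bis_inj; exact: gset_mulA. Qed.

HB.instance Definition _ := isSemigroup.Build (bisections aG) bis_mulA.

Lemma bis_mul_invK U : U * bis_inv U * U = U.
Proof. by apply: bis_inj; apply: gset_mul_invK; have [] := bisP U. Qed.

Lemma bis_inv_mulK U : bis_inv U * U * bis_inv U = bis_inv U.
Proof.
apply: bis_inj => /=; rewrite -{2}(gset_invK U); apply: gset_mul_invK.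
by apply: local_bisection_inv; have [] := bisP U.
Qed.

Lemma bis_inv_unique U V : U * V * U = U -> V * U * V = V -> V = bis_inv U.
Proof.
move=> /(congr1 (@bis_set gT G)) /= UVU /(congr1 (@bis_set gT G)) /= VUV.
have [[bU _ _] [bV _ _]] := (bisP U, bisP V).
apply: bis_inj => /=; apply/seteqP; split; first exact: gset_mul_weak_inverse.
have := gset_mul_weak_inverse bU UVU.
by move=> UV _ [a Ua <-]; have [b Vb <-] := UV _ Ua; rewrite ginvK.
Qed.

Lemma bis_mul0 U : bis_zero * U = bis_zero.
Proof. by apply: bis_inj; apply/seteqP; split=> // c [a [b []]]. Qed.

Lemma bis_0mul U : U * bis_zero = bis_zero.
Proof. by apply: bis_inj; apply/seteqP; split=> // c [a [b []]]. Qed.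

HB.instance Definition _ := Semigroup_isInverse0.Build (bisections aG)
  bis_mul_invK bis_inv_mulK bis_inv_unique bis_mul0 bis_0mul.

(* The [g] such that [U] lies over [g], which is unique unless [U] is empty. *)
Definition bis_deg U : gT :=
  xget 1 [set g | U `<=` @cocycle gT G @^-1` [set g]].

Lemma bis_degE U a : bis_set U a -> bis_deg U = cocycle a.
Proof.
move=> Ua; have [_ _ hU] := bisP U.
by have /(_ _ Ua) := xgetPex 1 hU.
Qed.

Lemma bis_deg_mul U V : U * V <> zero -> bis_deg (U * V) = bis_deg U * bis_deg V.
Proof.
move=> UV0; have [[c UVc]|no] := pselect (exists c, bis_set (U * V) c); last first.
  by case: UV0; apply: bis_inj; apply/seteqP; split=> // c UVc; case: no; exists c.
have [a [b [Ua Vb ab e]]] := UVc.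
by rewrite (bis_degE UVc) e cocycle_mul // (bis_degE Ua) (bis_degE Vb).
Qed.

Definition bisection_grading : grading gT (bisections aG) := Grading bis_deg_mul.

End BisectionSemigroup.

(* Main.v *)
(* Stone duality, with arrows.  A point x of the unit space yields the maximal
   character e |-> [x in e] of the compact open sets, and every maximal character
   arises so.  An arrow a yields the germ [U, x] at x = d(a) of any homogeneous
   compact bisection U containing a.  Such U form a basis of the arrow space, so
   the germ does not depend on U; conversely a germ [U, x] determines the unique
   arrow of U with domain x.  Both maps are continuous and open. *)

Require Import Defs.
From mathcomp Require Import all_boot all_order generic_quotient.
From mathcomp Require Import all_classical topology.

Set Implicit Arguments.
Unset Strict Implicit.
Unset Printing Implicit Defensive.

Local Open Scope classical_set_scope.
Local Open Scope group_scope.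

(** * Boolean spaces and the units of an etale groupoid *)

Lemma boolean_space_nbhs (X : topologicalType) (x : X) (A : set X) :
  boolean_space X -> nbhs x A ->
  exists K : set X, [/\ compact K, open K, K x & K `<=` A].
Proof.
by move=> [_ [_ /(_ x) b]] /b[K [[cK oK] Kx] KA]; exists K.
Qed.

Section EtaleUnits.
Variable G : topological_groupoid.
Hypothesis eG : etale G.

Lemma etale_gdom_inj_nbhs (a : garr G) :
  exists U : set (garr G), [/\ open U, U a & set_inj U (@gdom G)].
Proof.
have [U [oU Ua _ [g [_ _ gK]]]] := eG a; exists U; split=> // b c.
by move=> /set_mem/gK + /set_mem/gK + e => <- <-; rewrite e.
Qed.

(** Let [gdom] be injective on an open [U] around [gid x]. An arrow [a] near [gid x] lies in [U]
    together with [gid (gdom a)]; these share their domain, so [a] is an identity. *)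
Lemma etale_gid_open (K : set (gobj G)) : open K -> open (@gid G @` K).
Proof.
move=> oK; rewrite openE => _ [x Kx <-].
have [U [oU Ux iU]] := etale_gdom_inj_nbhs (gid x).
have oV : open (K `&` @gid G @^-1` U).
  by apply: openI => //; apply: ((continuousP _).1 (@gid_cont G)).
have nx : nbhs (gid x) (@gdom G @^-1` (K `&` @gid G @^-1` U)).
  by apply: (@gdom_cont G); rewrite gdom_id; exact: open_nbhs_nbhs.
apply: filterS (filterI (open_nbhs_nbhs (conj oU Ux)) nx) => a [Ua [Ka Uia]].
exists (gdom a) => //; apply: iU; [exact: mem_set | exact: mem_set |].
by rewrite gdom_id.
Qed.

End EtaleUnits.

Section Reconstruction.
Variables (gT : groupType) (G : graded_groupoid gT) (aG : ample G).
Local Notation S := (bisections aG).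
Local Notation E := (idempotents S).
Local Notation X := (spectrum E).
Implicit Types (U V W : S) (e f : E) (x y : gobj G) (a b : garr G).

Let eG : etale G. Proof. by case: aG. Qed.
Let bG : boolean_space (gobj G). Proof. by case: aG. Qed.
Let hG0 : hausdorff_space (gobj G). Proof. by case: bG. Qed.

(** * Homogeneous compact bisections as a base of the arrow space *)

Lemma bis_gdom_inj U a b :
  bis_set U a -> bis_set U b -> gdom a = gdom b -> a = b.
Proof.
by move=> Ua Ub; have [[_ dU _] _ _] := bisP U; apply: dU; exact: mem_set.
Qed.

Lemma bis_gran_inj U a b :
  bis_set U a -> bis_set U b -> gran a = gran b -> a = b.
Proof.
by move=> Ua Ub; have [[_ _ rU] _ _] := bisP U; apply: rU; exact: mem_set.
Qed.

Lemma bis_open U : open (bis_set U).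
Proof. by have [[]] := bisP U. Qed.

Lemma bis_gdom_open U : open (@gdom G @` bis_set U).
Proof. apply: local_homeo_open => //; exact: bis_open. Qed.

Lemma bis_gdom_compact U : compact (@gdom G @` bis_set U).
Proof.
have [_ cU _] := bisP U; apply: continuous_compact => //.
by apply: continuous_subspaceT; exact: (@gdom_cont G).
Qed.

Lemma bis_gdom_closed U : closed (@gdom G @` bis_set U).
Proof. by apply: compact_closed => //; exact: bis_gdom_compact. Qed.

Lemma bis_base a (A : set (garr G)) : nbhs a A ->
  exists U, bis_set U a /\ bis_set U `<=` A.
Proof.
rewrite nbhsE => -[A' [oA' A'a] A'A].
have [U0 [oU0 U0a _ [g [_ cg gK]]]] := eG a.
have [U1 [oU1 U1a iU1]] := etale_gdom_inj_nbhs eG (ginv a).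
pose C := @cocycle gT G @^-1` [set cocycle a].
have oC : open C.
  by apply: ((continuousP _).1 (@cocycle_cont gT G)); exact: discrete_open.
(* [U0] carries a continuous inverse of [gdom], [C] forces homogeneity, and the last factor makes
   [gran] injective, since [gdom] is injective on [U1]. *)
pose O := U0 `&` A' `&` C `&` (@ginv G @^-1` U1).
have oO : open O.
  apply: openI; last by apply: ((continuousP _).1 (@ginv_cont G)).
  by apply: openI => //; exact: openI.
have Oa : O a by [].
have odO : open (@gdom G @` O) by exact: local_homeo_open.
have [|K [cK oK Ka KO]] := @boolean_space_nbhs _ (gdom a) (@gdom G @` O) bG.
  by apply: open_nbhs_nbhs; split=> //; exists a.
pose U := O `&` @gdom G @^-1` K.
(* As the image of [K] under the local section [g], the set [U] is compact. *)
have UE : U = g @` K.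
  apply/seteqP; split=> [b [Ob Kb]|_ [x Kx <-]].
    by exists (gdom b) => //; apply: gK; have [[[]]] := Ob.
  have [b Ob bx] := KO _ Kx; rewrite -bx gK; last by have [[[]]] := Ob.
  by split=> //; rewrite /= bx.
have hU : hc_bisection U.
  split; last by exists (cocycle a) => b [[[_ Cb] _] _].
  - split.
    + by apply: openI => //; apply: ((continuousP _).1 (@gdom_cont G)).
    + move=> b c /set_mem[[[[b0 _] _] _] _] /set_mem[[[[c0 _] _] _] _] e.
      by rewrite -(gK _ b0) -(gK _ c0) e.
    + move=> b c /set_mem[[_ b1] _] /set_mem[[_ c1] _] e.
      rewrite -(ginvK b) -(ginvK c); congr ginv; apply: iU1.
      * exact: mem_set.
      * exact: mem_set.
      * by rewrite !gdom_inv.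
  - rewrite UE; apply: continuous_compact cK.
    apply: continuous_subspaceW cg => x /KO[b Ob <-].
    by exists b => //; have [[[]]] := Ob.
exists (Bisection hU : S); split=> //.
by move=> b [[[[_ A'b] _] _] _]; exact: A'A.
Qed.

(** * Idempotents, the natural order and compact open sets of units *)

(** Factor [a] as a product of two arrows of [U]. The first shares its range and the second its
    domain, so both equal [a], and [a] is idempotent. *)
Lemma bis_idem_gid U a : U * U = U -> bis_set U a -> a = gid (gdom a).
Proof.
move=> UU Ua; have := Ua; rewrite -{1}UU => -[b [c [Ub Uc bc e]]].
have ab : a = b by apply: (bis_gran_inj Ua Ub); rewrite e gran_mul.
have ac : a = c by apply: (bis_gdom_inj Ua Uc); rewrite e gdom_mul.
by subst b c; apply: gid_inv.
Qed.

Lemma idem_gid e a : bis_set (val e) a -> a = gid (gdom a).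
Proof. by apply: bis_idem_gid; exact: idemE. Qed.

(** Two views of the support of [e]: the preimage suits membership, while the image is visibly
    compact, open and closed. *)
Lemma gid_preim_gdom e : @gid G @^-1` bis_set (val e) = @gdom G @` bis_set (val e).
Proof.
apply/seteqP; split=> [x ex|_ [a ea <-]]; first by exists (gid x); rewrite ?gdom_id.
by rewrite /= -(idem_gid ea).
Qed.

(** The identities over [K] form an open set because [G] is etale, and they lie over the degree
    1. *)
Lemma idem_of_compact_open (K : set (gobj G)) : compact K -> open K ->
  exists e, @gid G @^-1` bis_set (val e) = K.
Proof.
move=> cK oK; pose U := @gid G @` K.
have hU : hc_bisection U.
  split; last by exists 1 => _ [x _ <-]; exact: cocycle_id.
  - split; first exact: etale_gid_open.
    + by move=> _ _ /set_mem[x _ <-] /set_mem[y _ <-]; rewrite !gdom_id => ->.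
    + by move=> _ _ /set_mem[x _ <-] /set_mem[y _ <-]; rewrite !gran_id => ->.
  - apply: continuous_compact cK.
    by apply: continuous_subspaceT; exact: (@gid_cont G).
have UU : (Bisection hU : S) * Bisection hU == Bisection hU.
  apply/eqP/bis_inj/seteqP; split.
    move=> c [_ [_ [[x Kx <-] [y Ky <-]]]]; rewrite gdom_id gran_id => xy ->.
    by subst y; exists x => //; rewrite -{3}(gdom_id x) gmul_id.
  move=> _ [x Kx <-]; exists (gid x), (gid x); split=> //.
  - by exists x.
  - by exists x.
  - by rewrite gdom_id gran_id.
  - by rewrite -{3}(gdom_id x) gmul_id.
exists (Idempotent UU); apply/seteqP; split=> [x [y Ky] /= xy|x Kx].
  by rewrite -(gdom_id x) -xy gdom_id.
by exists x.
Qed.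

(** Multiplying [V] by an idempotent, which holds only identities, merely discards arrows.
    Conversely [U^* * U] is the set of identities at the domains of [U], and restricting [V] to them
    gives [U]. *)
Lemma ile_bisP U V : ile U V <-> bis_set U `<=` bis_set V.
Proof.
split=> [[W WW ->] _ [a [b [Va Wb ab ->]]]|UV].
  have bE := bis_idem_gid WW Wb.
  have da : gdom a = gdom b by rewrite ab bE gran_id gdom_id.
  by rewrite bE -da gmul_id.
exists (U^* * U); first exact: star_mulP.
apply: bis_inj; apply/seteqP; split.
  move=> a Ua; exists a, (gid (gdom a)); split=> //; first exact: UV.
  - exists (ginv a), a; split=> //; first by exists a.
      by rewrite gdom_inv.
    by rewrite ginv_mul.
  - by rewrite gran_id.
  - by rewrite gmul_id.
move=> _ [b [_ [Vb [_ [a [[a' Ua' <-] Ua + ->]] + ->]]]].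
rewrite gdom_inv => e; have aa' : a' = a by exact: bis_gran_inj Ua' Ua e.
subst a'; rewrite ginv_mul gran_id => ba; rewrite -ba gmul_id.
by rewrite (bis_gdom_inj Vb (UV _ Ua) ba).
Qed.

(** * The homeomorphism from the unit space to the spectrum *)

Definition point_char x : E -> bool := fun e => `[< bis_set (val e) (gid x) >].

Lemma point_charP x e : point_char x e <-> bis_set (val e) (gid x).
Proof. by split=> /asboolP. Qed.

Lemma point_char_compact_open x (A : set (gobj G)) : nbhs x A ->
  exists e, point_char x e /\ forall y, point_char y e -> A y.
Proof.
move=> /(boolean_space_nbhs bG)[K [cK oK Kx KA]].
have [e eK] := idem_of_compact_open cK oK; rewrite -eK in Kx KA.
by exists e; split=> [|y /point_charP ey]; [exact/point_charP | exact: KA].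
Qed.

Lemma point_char_character x : is_character (point_char x).
Proof.
split.
- by have [e [ex _]] := point_char_compact_open (@filterT _ _ (nbhs_filter x)); exists e.
- by apply/asboolP.
- move=> e f; apply/idP/andP.
    move=> /point_charP[a [b [ea fb ab xE]]].
    have ba : b = a by rewrite (idem_gid ea) ab (idem_gid fb) gran_id.
    subst b; have xa : gid x = a by rewrite xE {2}(idem_gid ea) gmul_id.
    by split; apply/point_charP; rewrite xa.
  move=> [/point_charP ex /point_charP fx]; apply/point_charP.
  exists (gid x), (gid x); rewrite gdom_id gran_id; split=> //.
  by rewrite -{3}(gdom_id x) gmul_id.
Qed.

Lemma point_char_maximal x : maximal_character (point_char x).
Proof.
split=> [|sigma [_ s0 sM] le]; first exact: point_char_character.
apply/funext => e; apply/idP/idP; last exact: le.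
move=> se; apply: contrapT => /negP xe.
(* The support of [e] is closed and misses [x], so some [f] containing [x] is disjoint from it. Then
   [sigma] is 1 on [f] and on [e], yet 0 on their meet. *)
have [|f [fx fe]] := @point_char_compact_open x (~` (@gdom G @` bis_set (val e))).
  apply: open_nbhs_nbhs; split; first exact/closed_openC/bis_gdom_closed.
  by rewrite -gid_preim_gdom => /point_charP; exact/negP.
have : sigma (idem_meet f e) by rewrite (sM f e) se (le _ fx).
rewrite (_ : idem_meet f e = \bot%O) ?s0 //.
apply: val_inj; apply: bis_inj; apply/seteqP; split=> // c [a [b [fa eb ab _]]].
apply: (fe (gdom a)); first by apply/point_charP; rewrite -(idem_gid fa).
by exists b => //; rewrite ab (idem_gid eb) gdom_id gran_id.
Qed.

Definition point_spectrum x : X :=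
  exist _ (point_char x : {ptws E -> bool}) (mem_set (point_char_maximal x)).

Lemma char_val_point x : char_val (point_spectrum x) = point_char x.
Proof. by []. Qed.

Lemma point_spectrum_inj : injective point_spectrum.
Proof.
move=> x y xy; apply: hG0 => A B nA nB.
have [e [ex eA]] := point_char_compact_open nA.
exists y; split; last exact: nbhs_singleton.
by apply: eA; rewrite -char_val_point -xy.
Qed.

(* Compactness gives a point in the supports of all the idempotents on which
   [tau] is 1; its character dominates [tau], hence equals it by maximality. *)
Lemma point_spectrum_surj (tau : X) : exists x, point_spectrum x = tau.
Proof.
have [[[e0 t0] tz tM] mt] := char_valP tau.
pose D e := @gdom G @` bis_set (val e).
pose F := filter_from [set e | char_val tau e] D.
have FF : ProperFilter F.
  apply: filter_from_proper; last first.
    move=> e te; apply: contrapT => no; move: te; rewrite /= (_ : e = \bot%O) ?tz //.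
    apply: val_inj; apply: bis_inj; apply/seteqP; split=> // a ea.
    by case: no; exists (gdom a), a.
  apply: filter_from_filter; first by exists e0.
  move=> e f te tf; exists (idem_meet e f); first by rewrite /= (tM e f) te tf.
  rewrite /D -!gid_preim_gdom => x /point_charP.
  by rewrite (char_mul _ _ (point_char_character x)) => /andP[/point_charP ex /point_charP].
have [|x [_ xF]] := @bis_gdom_compact (val e0) F FF; first by exists e0.
exists x; apply: char_val_inj; apply: mt; first exact: point_char_character.
move=> e te; apply/point_charP.
suff : D e x by rewrite /D -gid_preim_gdom.
by apply: (@bis_gdom_closed (val e)) => B nB; apply: xF nB; exists e.
Qed.

(** Supports of idempotents are clopen, so each evaluation at [e] is locally constant in [x]. *)
Lemma point_spectrum_cont : continuous point_spectrum.
Proof.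
move=> x; apply: spectrum_cvg => e V /nbhs_singleton.
rewrite char_val_point nbhs_filterE => Vx.
have [ex|ex] := boolP (point_char x e).
  have : nbhs x (@gdom G @` bis_set (val e)).
    apply: open_nbhs_nbhs; split; first exact: bis_gdom_open.
    by rewrite -gid_preim_gdom; exact/point_charP.
  apply: filterS => y; rewrite -gid_preim_gdom /= => /point_charP ey.
  by rewrite char_val_point ey -ex.
have : nbhs x (~` (@gdom G @` bis_set (val e))).
  apply: open_nbhs_nbhs; split; first exact/closed_openC/bis_gdom_closed.
  by rewrite -gid_preim_gdom => /point_charP; exact/negP.
apply: filterS => y; rewrite -gid_preim_gdom /= => ey.
rewrite char_val_point; suff -> : point_char y e = point_char x e by [].
by rewrite (negbTE ex); apply/negP => /point_charP.
Qed.

(** The characters equal to 1 at a small [e] around [x] form an open set; by surjectivity they all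
    come from points of [A]. *)
Lemma point_spectrum_open x (A : set (gobj G)) : nbhs x A ->
  nbhs (point_spectrum x) (point_spectrum @` A).
Proof.
move=> /point_char_compact_open[e [ex eA]].
have nt : nbhs (char_val (point_spectrum x) e) [set true].
  by apply: open_nbhs_nbhs; split; [exact: discrete_open | rewrite char_val_point ex].
have /= := spectrum_eval_cont nt; apply: (@filterS _ _ (nbhs_filter _)).
move=> tau; have [y <-] := point_spectrum_surj tau.
by rewrite /= char_val_point => /eA Ay; exists y.
Qed.

(** * The isomorphism from arrows to germs *)

Lemma point_dom U a : bis_set U a ->
  adom (spectral_action S) U (point_spectrum (gdom a)).
Proof.
move=> Ua; apply/point_charP; exists (ginv a), a; split=> //; first by exists a.
  by rewrite gdom_inv.
by rewrite ginv_mul.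
Qed.

Lemma point_dom_ex U x : adom (spectral_action S) U (point_spectrum x) ->
  exists a, bis_set U a /\ gdom a = x.
Proof.
move=> /point_charP[b [a [_ Ua ba xE]]]; exists a; split=> //.
by rewrite -(gdom_id x) xE gdom_mul.
Qed.

(** The only arrow of [U] with domain [gdom a] is [a], so [U^* * e * U] contains the identity at
    [gdom a] exactly when [e] contains the one at [gran a]. *)
Lemma point_act U a : bis_set U a ->
  act (spectral_action S) U (point_spectrum (gdom a)) = point_spectrum (gran a).
Proof.
move=> Ua; apply: char_val_inj.
rewrite spectrum_actE ?char_val_point; last exact: point_dom.
apply/funext => e; apply/idP/idP => /point_charP.
  move=> [c [b [[c' [b' [[u Uu <-] eb cb ->]]] Ub e1 e2]]].
  have ba : b = a.
    by apply: (bis_gdom_inj Ub Ua); rewrite -[RHS](gdom_id (gdom a)) e2 gdom_mul.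
  subst b; move: e1; rewrite gdom_mul // => e1.
  by apply/point_charP; rewrite -e1 -(idem_gid eb).
move=> ea; apply/point_charP.
have e1 : gmul (ginv a) (gid (gran a)) = ginv a by rewrite -gdom_inv gmul_id.
exists (ginv a), a; split=> //; rewrite ?gdom_inv ?ginv_mul //.
by exists (ginv a), (gid (gran a)); rewrite gdom_inv gran_id; split=> //; exists a.
Qed.

Lemma bisection_at a : exists U, bis_set U a.
Proof. by have [U []] := bis_base (@filterT _ _ (nbhs_filter a)); exists U. Qed.

(** The bisection around [a] is chosen arbitrarily; [arrow_germE] allows any other. *)
Definition arrow_germ a : germs (spectral_action S) :=
  germ (point_dom (projT2 (cid (bisection_at a)))).

Lemma point_germ_eq U V a b (Ua : bis_set U a) (Vb : bis_set V b) :
  germ (point_dom Ua) = germ (point_dom Vb) <-> a = b.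
Proof.
split=> [/germ_eq[/point_spectrum_inj ab [W [/ile_bisP WU /ile_bisP WV]]]|ab].
  move=> /point_dom_ex[c [Wc ca]].
  rewrite -(bis_gdom_inj (WU _ Wc) Ua ca); apply: (bis_gdom_inj (WV _ Wc) Vb).
  by rewrite ca.
subst b; apply/germ_eq; split=> //.
(* A bisection around [a] inside both [U] and [V] is a common lower bound, hence witnesses equality
   of germs. *)
have [|W [Wa WUV]] := @bis_base a (bis_set U `&` bis_set V).
  by apply: open_nbhs_nbhs; split=> //; apply: openI; exact: bis_open.
exists W; split; last exact: point_dom.
- by apply/ile_bisP => b /WUV[].
- by apply/ile_bisP => b /WUV[].
Qed.

Lemma arrow_germE U a (Ua : bis_set U a) : arrow_germ a = germ (point_dom Ua).
Proof. exact/point_germ_eq. Qed.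

Lemma arrow_germ_inj : injective arrow_germ.
Proof. by move=> a b /point_germ_eq. Qed.

(** The arrows of [U] fill the whole basic open set of germs of [U]; this yields both surjectivity
    and openness. *)
Lemma arrow_germ_slice U (tau : X) (Utau : adom (spectral_action S) U tau) :
  exists a, bis_set U a /\ arrow_germ a = germ Utau.
Proof.
have [x xtau] := point_spectrum_surj tau; subst tau.
have [a [Ua ax]] := point_dom_ex Utau; subst x; exists a; split=> //.
by rewrite (arrow_germE Ua); exact: germ_irr.
Qed.

Lemma arrow_germ_surj g : exists a, arrow_germ a = g.
Proof.
have [U [tau [Utau ->]]] := germP g.
by have [a [_ aE]] := arrow_germ_slice Utau; exists a.
Qed.

Lemma arrow_germ_cont : continuous arrow_germ.
Proof.
move=> a W; have [U Ua] := bisection_at a; rewrite (arrow_germE Ua).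
move=> /nbhs_germ[N [nN NW]].
have nU : nbhs a (bis_set U) by apply: open_nbhs_nbhs; split=> //; exact: bis_open.
have nd : nbhs a (@gdom G @^-1` (point_spectrum @^-1` N)).
  by apply: (@gdom_cont G); exact: point_spectrum_cont.
apply: filterS (filterI nU nd) => b [Ub Nb] /=.
by rewrite (arrow_germE Ub); exact: NW.
Qed.

Lemma arrow_germ_open a (A : set (garr G)) : nbhs a A ->
  nbhs (arrow_germ a) (arrow_germ @` A).
Proof.
move=> /bis_base[U [Ua UA]]; rewrite (arrow_germE Ua); apply/nbhs_germ.
exists setT; split=> [|tau Utau _]; first exact: filterT.
by have [b [Ub bE]] := arrow_germ_slice Utau; exists b => //; exact: UA.
Qed.

Lemma arrow_germ_dom a : germ_dom (arrow_germ a) = point_spectrum (gdom a).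
Proof. by rewrite germ_domE. Qed.

Lemma arrow_germ_ran a : germ_ran (arrow_germ a) = point_spectrum (gran a).
Proof.
by have [U Ua] := bisection_at a; rewrite (arrow_germE Ua) germ_ranE point_act.
Qed.

Lemma arrow_germ_id x :
  arrow_germ (gid x) = germ_id (spectral_action S) (point_spectrum x).
Proof.
have [e [/point_charP ex _]] :=
  point_char_compact_open (@filterT _ _ (nbhs_filter x)).
have dx : adom (spectral_action S) (val e) (point_spectrum x).
  by have := point_dom ex; rewrite gdom_id.
by rewrite (arrow_germE ex) (germ_idE dx (idemE e)); apply: germ_irr; rewrite gdom_id.
Qed.

Lemma arrow_germ_mul a b : gdom a = gran b ->
  arrow_germ (gmul a b) = germ_mul (arrow_germ a) (arrow_germ b).
Proof.
move=> ab; have [[U Ua] [V Vb]] := (bisection_at a, bisection_at b).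
have UVab : bis_set (U * V) (gmul a b) by exists a, b.
rewrite (arrow_germE Ua) (arrow_germE Vb) (arrow_germE UVab).
have Uact : adom (spectral_action S) U
    (act (spectral_action S) V (point_spectrum (gdom b))).
  by rewrite point_act // -ab; exact: point_dom.
(* [germ_mulE] needs the left germ based at the translate by [V], which is the point of [gran b],
   that is of [gdom a]. *)
rewrite (germ_irr (point_dom Ua) Uact) ?point_act ?ab // germ_mulE.
by apply: germ_irr; rewrite gdom_mul.
Qed.

Lemma arrow_germ_deg a :
  germ_deg (bisection_grading aG) (arrow_germ a) = cocycle a.
Proof.
by have [U Ua] := bisection_at a; rewrite (arrow_germE Ua) germ_degE; exact: bis_degE.
Qed.

End Reconstruction.

(** * Inverting an open bijective functor, and conclusion *)

(** Openness makes the inverses continuous; each functor law for them is checked after applying the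
    injective [f0] or [f1]. *)
Lemma bijective_continuous_functor (G H : topological_groupoid)
    (f0 : gobj G -> gobj H) (f1 : garr G -> garr H) :
  continuous_functor f0 f1 ->
  injective f0 -> (forall y, exists x, f0 x = y) ->
  injective f1 -> (forall b, exists a, f1 a = b) ->
  (forall x A, nbhs x A -> nbhs (f0 x) (f0 @` A)) ->
  (forall a A, nbhs a A -> nbhs (f1 a) (f1 @` A)) ->
  exists g0 g1, [/\ continuous_functor g0 g1, cancel f0 g0 /\ cancel g0 f0 &
    cancel f1 g1 /\ cancel g1 f1].
Proof.
move=> [_ fd fr fi fm] i0 /choice[g0 g0K] i1 /choice[g1 g1K] o0 o1.
have f0K : cancel f0 g0 by move=> x; apply: i0.
have f1K : cancel f1 g1 by move=> a; apply: i1.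
have gd b : gdom (g1 b) = g0 (gdom b) by apply: i0; rewrite g0K -fd g1K.
have gr b : gran (g1 b) = g0 (gran b) by apply: i0; rewrite g0K -fr g1K.
exists g0, g1; split=> //; split=> //.
- split=> [y|b] A nA.
    by have := o0 _ _ nA; rewrite g0K; apply: filterS => _ [x Ax <-]; rewrite /= f0K.
  by have := o1 _ _ nA; rewrite g1K; apply: filterS => _ [a Aa <-]; rewrite /= f1K.
- by move=> y; apply: i1; rewrite g1K fi g0K.
- by move=> a b ab; apply: i1; rewrite fm ?g1K // gd gr ab.
Qed.

Theorem theorem3p3 (gT : groupType) (G : graded_groupoid gT)
    (aG : ample G) (hG : hausdorff_space (garr G)) :
  graded_isomorphic G
    (graded_germ_groupoid (bisection_grading aG)
                          (spectral_action (bisections aG))).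
Proof.
have F : @continuous_functor G (germ_groupoid (spectral_action (bisections aG)))
    (@point_spectrum _ _ aG) (@arrow_germ _ _ aG).
  split=> [|a|a|x|a b].
  - by split; [exact: point_spectrum_cont | exact: arrow_germ_cont].
  - exact: arrow_germ_dom.
  - exact: arrow_germ_ran.
  - exact: arrow_germ_id.
  - exact: arrow_germ_mul.
have [g0 [g1 [Fg K0 K1]]] := bijective_continuous_functor F
  (@point_spectrum_inj _ _ aG) (@point_spectrum_surj _ _ aG)
  (@arrow_germ_inj _ _ aG) (@arrow_germ_surj _ _ aG)
  (@point_spectrum_open _ _ aG) (@arrow_germ_open _ _ aG).
exists (@point_spectrum _ _ aG), (@arrow_germ _ _ aG), g0, g1; split=> //.
exact: arrow_germ_deg.
Qed.
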